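(* Let $S$ be a Damek--Ricci space. For every $r,t>0$, $$\Big|\frac{\partial}{\partial t}h_t(r)\Big|\lesssim\left(\left|\frac{r^2}{4t^2}-\frac{Q^2}{4}\right|+\frac1t\right)h_t(r).$$
   Context: Damek--Ricci space. Let $\nu\ge1$ and $\mu\ge0$ be integers and let $z\mapsto J_z$ be a linear map from $\mathbb{R}^\nu$ to skew-symmetric $\mu\times\mu$ real matrices such that $J_z$ is orthogonal whenever $|z|=1$ (so $\mu$ is even; the degenerate case $\mu=0$, where the variable $x$ is absent, is allowed). Let $(e_\ell)$, $(u_k)$ be the standard bases of $\mathbb{R}^\mu$, $\mathbb{R}^\nu$. $S=\mathbb{R}^\mu\times\mathbb{R}^\nu\times\mathbb{R}^+$ is the group with law $(x,z,a)(x',z',a')=\big(x+\sqrt a\,x',\,z+az'+\tfrac12\sqrt a\sum_{k=1}^\nu(J_{u_k}x,x')u_k,\,aa'\big)$ and identity $e=(0,0,1)$. Set $Q=(\mu+2\nu)/2$ and $n=\mu+\nu+1=\dim S$. Left-invariant vector fields: $\mathbb{X}_0=a\partial_a$, $\mathbb{X}_\ell=\sqrt a\big(\partial_{x_\ell}+\tfrac12\sum_{k=1}^\nu(J_{u_k}x,e_\ell)\partial_{z_k}\big)$ for $1\le\ell\le\mu$, $\mathbb{X}_{\mu+k}=a\,\partial_{z_k}$ for $1\le k\le\nu$. $S$ carries the left-invariant Riemannian metric for which $\mathbb{X}_0,\dots,\mathbb{X}_{n-1}$ are orthonormal; $d$ is the Riemannian distance and $r(\underline{x})=d(\underline{x},e)$.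 The left Haar measure is $d\lambda=a^{-Q-1}\,dx\,dz\,da$. Heat kernel. $\mathcal{L}=-\sum_{j=0}^{n-1}\mathbb{X}_j^2+Q\mathbb{X}_0$ is the (non-negative) Laplace--Beltrami operator, essentially self-adjoint on $L^2(\lambda)$; $h_t$ is the right-convolution kernel of $e^{-t\mathcal{L}}$ (i.e. $e^{-t\mathcal{L}}f=f*h_t$, $f*g(\underline{x})=\int_S f(y)g(y^{-1}\underline{x})\,d\lambda(y)$). It is radial and is viewed as a function $h_t(r)$ on $[0,\infty)$. Let $\mathfrak{c}_0=2^{-\mu-\frac\nu2-1}\pi^{-\frac n2}$. Explicitly, $h_t(r)=\mathfrak{c}_0t^{-1/2}e^{-Q^2t/4}\big(-\tfrac1{\sinh r}\partial_r\big)^{\nu/2}\big(-\tfrac1{\sinh(r/2)}\partial_r\big)^{\mu/2}e^{-r^2/(4t)}$ if $\nu$ is even, and $h_t(r)=\mathfrak{c}_0\pi^{-1/2}t^{-1/2}e^{-Q^2t/4}\int_r^\infty\frac{\sinh s}{\sqrt{\cosh s-\cosh r}}\big(-\tfrac1{\sinh s}\partial_s\big)^{(\nu+1)/2}\big(-\tfrac1{\sinh(s/2)}\partial_s\big)^{\mu/2}e^{-s^2/(4t)}\,ds$ if $\nu$ is odd. $v\lesssim w$ means $v\le Cw$ with a constant $C>0$ depending only on $S$ (not on $r,t$). *)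

(* Defs.v *)
From HB Require Import structures.
From mathcomp Require Import all_boot all_order all_algebra.
From mathcomp Require Import all_classical all_reals all_analysis.
Import Order.TTheory GRing.Theory Num.Theory.
Import numFieldNormedType.Exports.

Set Implicit Arguments.
Unset Strict Implicit.
Unset Printing Implicit Defensive.

Local Open Scope classical_set_scope.
Local Open Scope ring_scope.

(* The norm on matrices provided by MathComp-Analysis is the sup norm, hence
   this separate definition. *)
Definition euclid_norm (R : realType) (n : nat) (z : 'rV[R]_n) : R :=
  Num.sqrt (\sum_(i < n) z 0 i ^+ 2).

(* A Damek-Ricci space R^mu x R^nu x R^+ is determined by the data (mu, nu, J);
   mu = 0 is allowed. *)
Record damek_ricci (R : realType) := DamekRicci {
  dr_mu : nat;
  dr_nu : nat;
  dr_J : {linear 'rV[R]_dr_nu -> 'M[R]_dr_mu};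
  dr_nu_gt0 : (1 <= dr_nu)%N;
  dr_J_skew : forall z, (dr_J z)^T = - dr_J z;
  dr_J_orthogonal : forall z, euclid_norm z = 1 ->
    (dr_J z)^T *m dr_J z = 1%:M
}.

Lemma dr_mu_even (R : realType) (S : damek_ricci R) : ~~ odd (dr_mu S).
Proof.
case: S => mu nu J nu_gt0 skew orth /=; apply/negP => mu_odd.
pose z : 'rV[R]_nu := delta_mx 0 (Ordinal nu_gt0).
have z1 : euclid_norm z = 1.
  rewrite /euclid_norm (bigD1 (Ordinal nu_gt0)) //= big1 => [|i /negbTE ni].
    by rewrite addr0 mxE !eqxx expr1n sqrtr1.
  by rewrite mxE ni andbF expr0n.
have /(congr1 determinant) := orth z z1.
rewrite det_mulmx det_tr det1.
have : \det (J z) = - \det (J z).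
  rewrite -[LHS]det_tr skew -scaleN1r detZ -signr_odd mu_odd expr1.
  by rewrite mulN1r.
move=> /eqP; rewrite -subr_eq0 opprK -mulr2n mulrn_eq0 /= => /eqP ->.
by rewrite mul0r => /eqP; rewrite eq_sym oner_eq0.
Qed.

Section HeatKernel.
Variables (R : realType) (S : damek_ricci R).
Local Notation mu := (dr_mu S).
Local Notation nu := (dr_nu S).

Definition dr_Q : R := (mu%:R + 2 * nu%:R) / 2.

Definition dr_dim : nat := (mu + nu).+1.

Definition sinh (x : R) : R := (expR x - expR (- x)) / 2.
Definition cosh (x : R) : R := (expR x + expR (- x)) / 2.

(* - (1 / sinh s) d/ds and - (1 / sinh (s / 2)) d/ds; as x / 0 = 0, these are
   meaningful for s <> 0 only. *)
Definition Dsinh (f : R -> R) : R -> R :=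
  fun s => - (sinh s)^-1 * f^`()%classic s.
Definition Dsinh_half (f : R -> R) : R -> R :=
  fun s => - (sinh (s / 2))^-1 * f^`()%classic s.

Definition gauss (t s : R) : R := expR (- (s ^+ 2 / (4 * t))).

Definition heat_c0 : R :=
  2 `^ (- mu%:R - nu%:R / 2 - 1) * pi `^ (- (dr_dim%:R / 2)).

(* The radial profile h_t(r) of the convolution kernel of exp(- t L), L the
   Laplace-Beltrami operator of S, in the closed form known for Damek-Ricci
   spaces. Only r > 0 is meaningful: the value at r = 0 is defined by
   continuity in the literature, which is not the value of this expression. *)
Definition heat_kernel (t r : R) : R :=
  if odd nu then
    heat_c0 * pi `^ (- (1 / 2)) * t `^ (- (1 / 2)) * expR (- (dr_Q ^+ 2 * t / 4)) *
    \int[lebesgue_measure]_(s in `]r, +oo[)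
      (sinh s / Num.sqrt (cosh s - cosh r) *
       iter (nu.+1)./2 Dsinh (iter mu./2 Dsinh_half (gauss t)) s)
  else
    heat_c0 * t `^ (- (1 / 2)) * expR (- (dr_Q ^+ 2 * t / 4)) *
    iter nu./2 Dsinh (iter mu./2 Dsinh_half (gauss t)) r.

End HeatKernel.

(* Main.v *)
Require Import Defs.
From HB Require Import structures.
From mathcomp Require Import all_boot all_order all_algebra.
From mathcomp Require Import all_classical all_reals all_analysis.
From mathcomp Require Import measurable_realfun.
From mathcomp Require Import ring lra.
Import Order.TTheory GRing.Theory Num.Theory.
Import numFieldNormedType.Exports.
Local Open Scope classical_set_scope.
Local Open Scope ring_scope.

(** The kernel is A * t^(-1/2) * exp(- Q^2 t / 4) * X(t), where A >= 0 and X
    carries the dependence on r.  The two scalar factors contribute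
    - 1/(2t) - Q^2/4 to the logarithmic derivative in t, so it is enough to
    show |X' - r^2/(4t^2) X| <= (K/t) X with K independent of r and t
    (time_prefactor_bound).

    Set y = cosh(s/2).  The operator -(1/sinh(s/2)) d/ds is -(1/2) d/dy, and
    -(1/sinh s) d/ds is the same operator divided by 2y.  Applied to the
    Gaussian they produce Gaussian times b, where b stays in the semiring
    amplitude generated by 1/t, 1/y, the nonnegative constants and the
    functions (-d/dy)^k (arcosh y / sqrt(y^2 - 1)).  All generators are
    completely monotone in y, so b is nonnegative and nonincreasing in s.
    Moreover b is a polynomial in 1/t with nonnegative coefficients, whence
    0 <= - t d/dt b <= N b.  Since d/dt of the Gaussian at s is s^2/(4t^2)
    times the Gaussian, this settles the case of even nu, where X is such a
    product at s = r.

    For odd nu, X is the integral over s > r of the kernel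
    sinh s / sqrt(cosh s - cosh r) against P = -(1/sinh s) B', with B again
    Gaussian times amplitude.  Differentiation under the integral sign now
    produces s^2 in place of r^2, and the excess is absorbed by the estimate
      int (s^2 - r^2) k P <= 4 t int k P       (k the kernel)
    of excess_integral_le.  It comes from an integration by parts: moving the
    derivative of B onto (s^2 - r^2)/sqrt(cosh s - cosh r) costs at most the
    integral of 2 s B / sqrt(cosh s - cosh r), and as the amplitude of B is
    nonincreasing, - B' is at least what the Gaussian alone contributes,
    namely s B / (2t). *)

Set Implicit Arguments.
Unset Strict Implicit.
Unset Printing Implicit Defensive.

(** * Differentiation of real functions *)
Section Differentiation.
Context {R : realType}.
Implicit Types (f g : R -> R) (x a b : R).

Lemma is_derive_eval {f x a} : is_derive x 1 f a -> f^`()%classic x = a.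
Proof. by move=> df; rewrite derive1E; exact: derive_val. Qed.

Lemma is_derive_cont {f x a} : is_derive x 1 f a -> {for x, continuous f}.
Proof.
by move=> [df _]; apply: differentiable_continuous; exact/derivable1_diffP.
Qed.

(** The operators of the heat kernel divide by sinh s, so that the formulas for
    their iterates hold for s > 0 only; being local, derivatives can still be
    computed from them. *)
Lemma is_derive_pos_eq f g x a : 0 < x -> (forall y, 0 < y -> f y = g y) ->
  is_derive x 1 f a -> is_derive x 1 g a.
Proof.
move=> x0 fg; apply: near_eq_is_derive.
by near=> y; apply: fg; near: y; exact: lt_nbhsr.
Unshelve. all: by end_near. Qed.

Lemma is_derive_var x : is_derive x 1 (fun y : R => y) 1.
Proof. exact: is_derive_id. Qed.

Lemma is_derive_const c x : is_derive x 1 (fun _ : R => c : R) 0.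
Proof. exact: is_derive_cst. Qed.

Lemma is_derive_add f g x a b : is_derive x 1 f a -> is_derive x 1 g b ->
  is_derive x 1 (fun y => f y + g y) (a + b).
Proof. by move=> df dg; exact: is_deriveD. Qed.

Lemma is_derive_sub f g x a b : is_derive x 1 f a -> is_derive x 1 g b ->
  is_derive x 1 (fun y => f y - g y) (a - b).
Proof. by move=> df dg; exact: is_deriveB. Qed.

Lemma is_derive_mul f g x a b : is_derive x 1 f a -> is_derive x 1 g b ->
  is_derive x 1 (fun y => f y * g y) (a * g x + f x * b).
Proof.
move=> df dg; apply: (is_derive_eq (is_deriveM df dg)).
by rewrite addrC /GRing.scale/= mulrC.
Qed.

Lemma is_derive_scale c f x a : is_derive x 1 f a ->
  is_derive x 1 (fun y => c * f y) (c * a).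
Proof. by move=> df; exact: is_deriveZ. Qed.

Lemma is_derive_inv f x a : f x != 0 -> is_derive x 1 f a ->
  is_derive x 1 (fun y => (f y)^-1) (- a / f x ^+ 2).
Proof.
move=> fx0 df; apply: (is_derive_eq (is_deriveV fx0 df)).
by rewrite /GRing.scale/= mulNr mulrC mulNr.
Qed.

Lemma is_derive_exp n f x a : is_derive x 1 f a ->
  is_derive x 1 (fun y => f y ^+ n) (n%:R * f x ^+ n.-1 * a).
Proof.
move=> df; have -> : (fun y => f y ^+ n) = f ^+ n.
  by apply/funext => y; rewrite exprfctE.
exact: is_deriveX. Qed.

Lemma is_derive_comp f g x a b : is_derive (g x) 1 f a -> is_derive x 1 g b ->
  is_derive x 1 (fun y => f (g y)) (a * b).
Proof. by move=> df dg; exact: (is_derive1_comp df dg). Qed.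

Lemma is_derive_to f x a b : is_derive x 1 f a -> a = b -> is_derive x 1 f b.
Proof. by move=> df <-. Qed.

Lemma is_derive_half f x a : is_derive (x / 2) 1 f a ->
  is_derive x 1 (fun y => f (y / 2)) (a / 2).
Proof.
move=> df; have dh : is_derive x 1 (fun y : R => y / 2) 2^-1.
  apply: is_derive_to (is_derive_mul (is_derive_var x)
    (is_derive_const 2^-1 x)) _.
  by rewrite mulr0 addr0 mul1r.
exact: (@is_derive_comp f (fun y => y / 2) _ _ _ df dh).
Qed.

Lemma nondecreasing_from_derive a f (f' : R -> R) :
  (forall x, a <= x -> is_derive x 1 f (f' x)) ->
  (forall x, a <= x -> 0 <= f' x) ->
  forall x y, a <= x -> x <= y -> f x <= f y.
Proof.
move=> df f'0 x y ax xy; apply: (@ger0_derive1_le_cc _ f x y) => //.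
- move=> z; rewrite in_itv/= => /andP[/ltW xz _].
  by have [] := df z (le_trans ax xz).
- move=> z; rewrite in_itv/= => /andP[/ltW xz _].
  by rewrite (is_derive_eval (df z (le_trans ax xz))) f'0 // (le_trans ax).
- apply: derivable_within_continuous => z; rewrite in_itv/= => /andP[xz _].
  by have [] := df z (le_trans ax xz).
- by rewrite in_itv/= lexx xy.
- by rewrite in_itv/= lexx xy.
Qed.

End Differentiation.

(** * Hyperbolic functions *)
Section Hyperbolic.
Context {R : realType}.
Implicit Types x y : R.

Lemma is_derive_expRN x :
  is_derive x 1 (fun y : R => expR (- y)) (- expR (- x)).
Proof.
apply: is_derive_to (@is_derive_comp _ expR -%R _ _ _ (is_derive_expR (- x))
  (is_deriveNid x 1)) _.
by rewrite mulrN1.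
Qed.

Lemma is_derive_sinh x : is_derive x 1 (@sinh R) (cosh x).
Proof.
apply: is_derive_to (is_derive_mul
  (is_derive_sub (is_derive_expR x) (is_derive_expRN x))
  (is_derive_const 2^-1 x)) _.
by rewrite /cosh; ring.
Qed.

Lemma is_derive_cosh x : is_derive x 1 (@cosh R) (sinh x).
Proof.
apply: is_derive_to (is_derive_mul
  (is_derive_add (is_derive_expR x) (is_derive_expRN x))
  (is_derive_const 2^-1 x)) _.
by rewrite /sinh; ring.
Qed.

Lemma sinh0 : sinh 0 = 0 :> R.
Proof. by rewrite /sinh oppr0 subrr mul0r. Qed.

Lemma cosh_gt0 x : 0 < cosh x.
Proof. by rewrite /cosh divr_gt0// addr_gt0// expR_gt0. Qed.

Lemma sinh_gt0 x : 0 < x -> 0 < sinh x.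
Proof.
by move=> x0; rewrite /sinh divr_gt0// subr_gt0 ltr_expR; lra.
Qed.

Lemma sinh_ge0 x : 0 <= x -> 0 <= sinh x.
Proof. by rewrite le_eqVlt => /predU1P[<-|/sinh_gt0/ltW//]; rewrite sinh0. Qed.

Lemma sinh_double x : sinh x = 2 * sinh (x / 2) * cosh (x / 2).
Proof.
have e y : expR y = expR (y / 2) ^+ 2 by rewrite expr2 -expRD -splitr.
by rewrite /sinh /cosh (e x) (e (- x)) !mulNr; field.
Qed.

Lemma ler_cosh x y : 0 <= x -> x <= y -> cosh x <= cosh y.
Proof.
exact: (@nondecreasing_from_derive _ 0 _ _
  (fun z _ => is_derive_cosh z) sinh_ge0).
Qed.

Lemma ltr_cosh x y : 0 <= x -> x < y -> cosh x < cosh y.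
Proof.
move=> x0 xy; have := @MVT _ (@cosh R) (@sinh R) x y xy
  (fun z _ => is_derive_cosh z).
case=> [|z].
  apply: derivable_within_continuous => z _.
  by have [] := is_derive_cosh z.
rewrite in_itv/= => /andP[xz _] e; rewrite -subr_gt0 e mulr_gt0 ?subr_gt0//.
exact/sinh_gt0/(le_lt_trans x0).
Qed.

Lemma sinh_ge_id x : 0 <= x -> x <= sinh x.
Proof.
move=> x0; rewrite -subr_ge0.
have d (z : R) : 0 <= z -> is_derive z 1 (fun y : R => sinh y - y) (cosh z - 1).
  by move=> _; exact: (is_derive_sub (is_derive_sinh z) (is_derive_var z)).
have := nondecreasing_from_derive d _ (lexx 0) x0; rewrite sinh0 subrr; apply.
move=> z z0; rewrite subr_ge0; have := ler_cosh (lexx 0) z0.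
by rewrite {1}/cosh oppr0 expR0 divff// -mulr2n pnatr_eq0.
Qed.

(** The function 2 cosh z - z^2 is nondecreasing because z <= sinh z. *)
Lemma half_sqr_sub_le_cosh_sub x y : 0 <= x -> x <= y ->
  y ^+ 2 - x ^+ 2 <= 2 * (cosh y - cosh x).
Proof.
move=> x0 xy.
have d (z : R) : 0 <= z ->
    is_derive z 1 (fun y : R => 2 * cosh y - y ^+ 2) (2 * (sinh z - z)).
  move=> _; apply: is_derive_to (is_derive_sub
    (is_derive_scale 2 (is_derive_cosh z))
    (is_derive_exp 2 (is_derive_var z))) _.
  by rewrite /=; ring.
have := nondecreasing_from_derive d _ x0 xy.
have d0 (z : R) : 0 <= z -> 0 <= 2 * (sinh z - z).
  by move=> z0; rewrite mulr_ge0// subr_ge0 sinh_ge_id.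
by move=> /(_ d0); lra.
Qed.

End Hyperbolic.

(** * Complete monotonicity of arcosh y / sqrt (y^2 - 1) *)
Section ArcoshRatio.
Context {R : realType}.
Implicit Types x y : R.

(** With y = cosh x, the function phi(y) = arcosh y / sqrt (y^2 - 1) equals
    x / sinh x and satisfies (y^2 - 1) phi' + y phi = 1.  Differentiating this
    equation k + 1 times yields a recurrence between three consecutive
    derivatives of phi; arcosh_num k x is (- d/dy)^k phi cleared of its
    denominator sinh x ^ (2k + 1), and is computed by that recurrence. *)
Fixpoint arcosh_num k x : R :=
  if k is m.+1 then
    if m is l.+1 then
      (2 * l%:R + 3) * cosh x * arcosh_num m x
        - l.+1%:R ^+ 2 * sinh x ^+ 2 * arcosh_num l x
    else x * cosh x - sinh x
  else x.

Lemma arcosh_numSS k x : arcosh_num k.+2 x =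
  (2 * k%:R + 3) * cosh x * arcosh_num k.+1 x
    - k.+1%:R ^+ 2 * sinh x ^+ 2 * arcosh_num k x.
Proof. by []. Qed.

(** This relation, rather than the recurrence, where two terms have opposite
    signs, is what makes the numerators nonnegative: each one vanishes at 0 and
    its derivative is a nonnegative multiple of the previous one. *)
Lemma is_derive_arcosh_num k x :
  is_derive x 1 (arcosh_num k.+1) (k.+1%:R ^+ 2 * sinh x * arcosh_num k x).
Proof.
pose P k := is_derive x 1 (arcosh_num k.+1)
  (k.+1%:R ^+ 2 * sinh x * arcosh_num k x).
(* Differentiating the recurrence of rank m + 2 produces (2m + 1) cosh x G_m -
   sinh x G_m', with G for arcosh_num, and this is G_(m + 1) again.  The value a
   of G_m' stays abstract since it has another form for m = 0. *)
have step (m : nat) (a : R) : is_derive x 1 (arcosh_num m) a -> P m ->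
    (2 * m%:R + 1) * cosh x * arcosh_num m x - sinh x * a = arcosh_num m.+1 x ->
    P m.+1.
  move=> dm dSm e; rewrite /P.
  have -> : arcosh_num m.+2 = fun y =>
      (2 * m%:R + 3) * (cosh y * arcosh_num m.+1 y)
        - m.+1%:R ^+ 2 * (sinh y ^+ 2 * arcosh_num m y).
    apply/funext => y; rewrite arcosh_numSS.
    by move: (arcosh_num _ y) (arcosh_num _ y) => u v; ring.
  apply: is_derive_to (is_derive_sub
    (is_derive_scale _ (is_derive_mul (is_derive_cosh x) dSm))
    (is_derive_scale _ (is_derive_mul (is_derive_exp 2
      (is_derive_sinh x)) dm))) _.
  rewrite -e -!natr1 /=.
  by move: (arcosh_num _ x) => u; ring.
suff : P k /\ P k.+1 by case.
elim: k => [|k [Pk PSk]].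
  have P0 : P 0%N.
    apply: is_derive_to (is_derive_sub
      (is_derive_mul (is_derive_var x) (is_derive_cosh x))
        (is_derive_sinh x)) _.
    by rewrite /=; ring.
  split; first exact: P0.
  apply: (step 0%N 1 (is_derive_var x) P0).
  by rewrite /= mulr0 add0r mul1r mulr1 mulrC.
split; first exact: PSk.
apply: (step k.+1 _ Pk PSk).
rewrite arcosh_numSS -!natr1.
by move: (arcosh_num _ x) (arcosh_num _ x) => u v; ring.
Qed.

Lemma arcosh_num0 k : arcosh_num k.+1 0 = 0 :> R.
Proof.
elim: k => [|k IH]; first by rewrite /= sinh0 mul0r subrr.
by rewrite arcosh_numSS IH sinh0 expr0n/= !mulr0 mul0r subrr.
Qed.

Lemma arcosh_num_ge0 k x : 0 <= x -> 0 <= arcosh_num k x.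
Proof.
elim: k x => [//|k IH] x x0; rewrite -(arcosh_num0 k).
apply: (nondecreasing_from_derive
  (fun y _ => is_derive_arcosh_num k y)) x0 => //.
move=> y y0 /=; rewrite mulr_ge0 ?IH//.
by rewrite mulr_ge0 ?sqr_ge0 ?sinh_ge0.
Qed.

Definition arcosh_ratio k x : R := arcosh_num k x / sinh x ^+ k.*2.+1.

Lemma arcosh_ratio_ge0 k x : 0 < x -> 0 <= arcosh_ratio k x.
Proof.
move=> x0; rewrite divr_ge0 ?arcosh_num_ge0 ?ltW//.
by rewrite exprn_gt0// sinh_gt0.
Qed.

(** With y = cosh x, the operator sinh x d/dy is d/dx, so that the ratios are
    the successive derivatives of phi in y, up to sign. *)
Lemma is_derive_arcosh_ratio k x : 0 < x ->
  is_derive x 1 (arcosh_ratio k) (- (sinh x * arcosh_ratio k.+1 x)).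
Proof.
move=> /sinh_gt0/lt0r_neq0 sx0.
have step (a : R) : is_derive x 1 (arcosh_num k) a ->
    arcosh_num k.+1 x = (2 * k%:R + 1) * cosh x * arcosh_num k x - sinh x * a ->
    is_derive x 1 (arcosh_ratio k) (- (sinh x * arcosh_ratio k.+1 x)).
  move=> da e; apply: is_derive_to (is_derive_mul da
    (is_derive_inv (f := fun y => sinh y ^+ k.*2.+1) (expf_neq0 _ sx0)
       (is_derive_exp _ (is_derive_sinh x)))) _.
  rewrite /arcosh_ratio e doubleS !exprS /= -mul2n mulnC exprM expr2.
  have := expf_neq0 k sx0; rewrite -natr1 natrM.
  by move: (sinh x ^+ k) => S S0; field; rewrite sx0 S0.
case: k step => [|k] step.
  by apply: step (is_derive_var x) _; rewrite /= mulr0 add0r mul1r mulr1 mulrC.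
apply: step (is_derive_arcosh_num k x) _.
rewrite arcosh_numSS -!natr1.
by move: (arcosh_num _ x) (arcosh_num _ x) => u v; ring.
Qed.

End ArcoshRatio.

(** * The semiring of amplitudes *)
Section Amplitudes.
Context {R : realType}.
Implicit Types (b : R -> R -> R) (s t : R).

(** A semiring of functions of (t, s) that is stable under both operators of
    the heat kernel once the Gaussian is factored out.  Each property needed
    below passes through sums and products, so that it has to be checked on the
    generators only. *)
Inductive amplitude : (R -> R -> R) -> Prop :=
| amplitude_inv_time : amplitude (fun t _ => t^-1)
| amplitude_arcosh_ratio k : amplitude (fun _ s => arcosh_ratio k (s / 2))
| amplitude_sech : amplitude (fun _ s => (cosh (s / 2))^-1)
| amplitude_const c : 0 <= c -> amplitude (fun _ _ => c)
| amplitude_add b1 b2 : amplitude b1 -> amplitude b2 ->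
    amplitude (fun t s => b1 t s + b2 t s)
| amplitude_mul b1 b2 : amplitude b1 -> amplitude b2 ->
    amplitude (fun t s => b1 t s * b2 t s).

Lemma amplitude_ge0 b t s : amplitude b -> 0 < t -> 0 < s -> 0 <= b t s.
Proof.
move=> ab t0 s0.
elim: {b} ab => [|k||c c0|b1 b2 _ ? _ ?|b1 b2 _ ? _ ?].
- by rewrite invr_ge0 ltW.
- by rewrite arcosh_ratio_ge0// divr_gt0.
- by rewrite invr_ge0 ltW// cosh_gt0.
- by [].
- exact: addr_ge0.
- exact: mulr_ge0.
Qed.

(** Stability under - (1/sinh (s/2)) d/ds: this derivation sends each
    arcosh_ratio to half the next one, and 1/cosh (s/2) to half its square. *)
Lemma amplitude_space_derivative b : amplitude b ->
  exists2 b', amplitude b' & forall t s, 0 < t -> 0 < s ->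
    is_derive s 1 (b t) (- (sinh (s / 2) * b' t s)).
Proof.
have zero : amplitude (fun _ _ => 0) by exact: amplitude_const.
have half : amplitude (fun _ _ => 2^-1).
  by apply: amplitude_const; rewrite invr_ge0.
elim=> [|k||c c0|b1 b2 a1 [c1 d1 e1] a2 [c2 d2 e2]
  |b1 b2 a1 [c1 d1 e1] a2 [c2 d2 e2]].
- exists (fun _ _ => 0) => // t s _ _.
  by apply: is_derive_to (is_derive_const _ s) _; rewrite mulr0 oppr0.
- exists (fun _ s => 2^-1 * arcosh_ratio k.+1 (s / 2)).
    by apply: (amplitude_mul half); exact: amplitude_arcosh_ratio.
  move=> t s _ s0.
  apply: is_derive_to (is_derive_half (is_derive_arcosh_ratio k (divr_gt0 s0
    (ltr0Sn _ 1)))) _.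
  by ring.
- exists (fun _ s => 2^-1 * ((cosh (s / 2))^-1 * (cosh (s / 2))^-1)).
    by apply: (amplitude_mul half); apply: amplitude_mul; exact: amplitude_sech.
  move=> t s _ s0; have c0 := lt0r_neq0 (cosh_gt0 (s / 2)).
  apply: is_derive_to (is_derive_inv (f := fun y => cosh (y / 2)) c0
    (is_derive_half (is_derive_cosh (s / 2)))) _.
  by field.
- exists (fun _ _ => 0) => // t s _ _.
  by apply: is_derive_to (is_derive_const _ s) _; rewrite mulr0 oppr0.
- exists (fun t s => c1 t s + c2 t s); first exact: amplitude_add.
  move=> t s t0 s0; apply: is_derive_to (is_derive_add (e1 t s t0 s0)
    (e2 t s t0 s0)) _.
  by ring.
- exists (fun t s => c1 t s * b2 t s + b1 t s * c2 t s).
    by apply: amplitude_add; exact: amplitude_mul.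
  move=> t s t0 s0; apply: is_derive_to (is_derive_mul (e1 t s t0 s0)
    (e2 t s t0 s0)) _.
  by ring.
Qed.

(** Amplitudes are polynomials in 1/t with nonnegative coefficients: t d/dt
    multiplies the monomial of degree j by - j, and N bounds the degree. *)
Lemma amplitude_time_derivative b : amplitude b ->
  exists N : nat, exists2 b', amplitude b' & forall t s, 0 < t -> 0 < s ->
    is_derive t 1 (b^~ s) (- b' t s) /\ t * b' t s <= N%:R * b t s.
Proof.
have zero : amplitude (fun _ _ => 0) by exact: amplitude_const.
have const (c : R) : 0 <= c -> forall t s : R,
    is_derive t 1 (fun _ => c) (- 0 : R) /\ t * 0 <= 0%:R * c.
  by move=> c0 t s; rewrite oppr0 mulr0 mul0r; split=> //;
    exact: is_derive_const.
elim=> [|k||c c0|b1 b2 a1 [N1 [c1 d1 e1]] a2 [N2 [c2 d2 e2]]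
  |b1 b2 a1 [N1 [c1 d1 e1]] a2 [N2 [c2 d2 e2]]].
- exists 1%N, (fun t _ => t^-1 * t^-1).
    by apply: amplitude_mul; exact: amplitude_inv_time.
  move=> t s t0 s0; have tn0 := lt0r_neq0 t0; split;
    last by rewrite mulrA divff.
  by apply: is_derive_to (is_derive_inv (f := fun y : R => y) tn0
    (is_derive_var t)) _; field.
- exists 0%N, (fun _ _ => 0) => // t s t0 s0; apply: const => //.
  by rewrite arcosh_ratio_ge0// divr_gt0.
- exists 0%N, (fun _ _ => 0) => // t s t0 s0; apply: const => //.
  by rewrite invr_ge0 ltW// cosh_gt0.
- by exists 0%N, (fun _ _ => 0) => // t s t0 s0; apply: const.
- exists (N1 + N2)%N, (fun t s => c1 t s + c2 t s); first exact: amplitude_add.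
  move=> t s t0 s0; have [f1 g1] := e1 t s t0 s0;
    have [f2 g2] := e2 t s t0 s0; split.
    by apply: is_derive_to (is_derive_add f1 f2) _; ring.
  have := amplitude_ge0 a1 t0 s0; have := amplitude_ge0 a2 t0 s0.
  have : 0 <= N1%:R :> R by []. have : 0 <= N2%:R :> R by [].
  by rewrite natrD; nra.
- exists (N1 + N2)%N, (fun t s => c1 t s * b2 t s + b1 t s * c2 t s).
    by apply: amplitude_add; exact: amplitude_mul.
  move=> t s t0 s0; have [f1 g1] := e1 t s t0 s0;
    have [f2 g2] := e2 t s t0 s0; split.
    by apply: is_derive_to (is_derive_mul f1 f2) _; ring.
  have b10 := amplitude_ge0 a1 t0 s0; have b20 := amplitude_ge0 a2 t0 s0.
  have := lerD (ler_wpM2r b20 g1) (ler_wpM2l b10 g2).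
  by rewrite natrD; congr (_ <= _); ring.
Qed.

Lemma amplitude_nincr_space b t s1 s2 : amplitude b -> 0 < t -> 0 < s1 ->
  s1 <= s2 -> b t s2 <= b t s1.
Proof.
move=> ab t0 s0 s12; have [b' ab' db] := amplitude_space_derivative ab.
rewrite -lerN2.
apply: (@nondecreasing_from_derive _ s1 (fun s => - b t s)
  (fun s => sinh (s / 2) * b' t s)) => // s s1s;
    have {}s0 := lt_le_trans s0 s1s.
  rewrite -[X in is_derive _ _ _ X]opprK; have := db t s t0 s0;
    exact: is_deriveN.
by rewrite mulr_ge0 ?(amplitude_ge0 ab')// sinh_ge0// divr_ge0// ltW.
Qed.

Lemma amplitude_nincr_time b t1 t2 s : amplitude b -> 0 < t1 -> 0 < s ->
  t1 <= t2 -> b t2 s <= b t1 s.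
Proof.
move=> ab t0 s0 t12; have [N [b' ab' db]] := amplitude_time_derivative ab.
rewrite -lerN2.
apply: (@nondecreasing_from_derive _ t1 (fun t => - b t s)
  (fun t => b' t s)) => // t t1t; have {}t0 := lt_le_trans t0 t1t.
  rewrite -[X in is_derive _ _ _ X]opprK; have [+ _] := db t s t0 s0;
    exact: is_deriveN.
exact: amplitude_ge0.
Qed.

End Amplitudes.

(** * Gaussians times amplitudes *)
Section GaussianAmplitudes.
Context {R : realType}.
Implicit Types (b Phi : R -> R -> R) (s t : R).

Lemma gauss_gt0 t s : 0 < gauss t s.
Proof. exact: expR_gt0. Qed.

Lemma is_derive_gauss_space t s : 0 < t ->
  is_derive s 1 (gauss t) (- (s / (2 * t) * gauss t s)).
Proof.
move=> t0; have tn0 := lt0r_neq0 t0.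
have E : gauss t = fun y => expR (- (4 * t)^-1 * y ^+ 2).
  by apply/funext => y; rewrite /gauss mulNr [in RHS]mulrC.
have := @is_derive_comp _ expR (fun y => - (4 * t)^-1 * y ^+ 2) _ _ _
  (is_derive_expR _) (is_derive_scale _ (is_derive_exp 2 (is_derive_var s))).
rewrite E => /is_derive_to; apply; rewrite /=.
by move: (expR _) => u; field.
Qed.

Lemma is_derive_gauss_time t s : 0 < t ->
  is_derive t 1 ((@gauss R)^~ s) (s ^+ 2 / (4 * t ^+ 2) * gauss t s).
Proof.
move=> t0; have tn0 := lt0r_neq0 t0.
have E u : gauss u s = expR (- (s ^+ 2 / 4) * u^-1).
  by rewrite /gauss invfM mulNr mulrA.
have := @is_derive_comp _ expR (fun u => - (s ^+ 2 / 4) * u^-1) _ _ _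
  (is_derive_expR _) (is_derive_scale _ (is_derive_inv (f := fun y => y) tn0
    (is_derive_var t))).
rewrite (_ : (@gauss R)^~ s = fun u => expR (- (s ^+ 2 / 4) * u^-1));
  last exact/funext.
move=> /is_derive_to; apply; rewrite E.
by move: (expR _) => u; field.
Qed.

Definition gauss_amplitude Phi b :=
  amplitude b /\ forall t s, 0 < t -> 0 < s -> Phi t s = gauss t s * b t s.

(** The Gaussian contributes s/(2t) to minus the logarithmic derivative in s,
    and the amplitude, being nonincreasing, contributes with the same sign;
    dropping the latter gives the lower bound, which drives the integration by
    parts below. *)
Lemma gauss_amplitude_derivative Phi b : gauss_amplitude Phi b ->
  exists b', [/\ amplitude b',
    forall t s, 0 < t -> 0 < s ->
      is_derive s 1 (Phi t) (- (sinh (s / 2) * (gauss t s * b' t s))) &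
    forall t s, 0 < t -> 0 < s ->
      s / (2 * t) * b t s <= sinh (s / 2) * b' t s].
Proof.
move=> [ab E]; have [b' ab' db] := amplitude_space_derivative ab.
exists (fun t s => t^-1 * arcosh_ratio 0 (s / 2) * b t s + b' t s).
have sh t s : 0 < t -> 0 < s ->
    sinh (s / 2) * (t^-1 * arcosh_ratio 0 (s / 2) * b t s + b' t s) =
    s / (2 * t) * b t s + sinh (s / 2) * b' t s.
  move=> t0 s0; have := lt0r_neq0 (@sinh_gt0 R (s / 2) (divr_gt0 s0
    (ltr0Sn _ 1))).
  have tn0 := lt0r_neq0 t0.
  rewrite /arcosh_ratio /= expr1 => S0.
  move: (sinh (s / 2)) S0 => S S0; move: (b t s) (b' t s) => u v.
  by field; rewrite tn0 S0.
split.
- apply: (amplitude_add _ ab'); apply: (amplitude_mul _ ab).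
  by apply: amplitude_mul;
    [exact: amplitude_inv_time | exact: amplitude_arcosh_ratio].
- move=> t s t0 s0.
  apply: (is_derive_pos_eq s0 (f := fun y => gauss t y * b t y)).
    by move=> y y0; rewrite E.
  apply: is_derive_to (is_derive_mul (is_derive_gauss_space s t0)
    (db t s t0 s0)) _.
  by rewrite mulrCA sh//; move: (gauss t s) (sinh _) => g S; ring.
- move=> t s t0 s0; rewrite sh// lerDl mulr_ge0 ?(amplitude_ge0 ab')//.
  by rewrite sinh_ge0// divr_ge0// ltW.
Qed.

Lemma gauss_amplitude_Dsinh_half Phi b : gauss_amplitude Phi b ->
  exists b', gauss_amplitude (fun t => Dsinh_half (Phi t)) b'.
Proof.
move=> /gauss_amplitude_derivative [b' [ab' dPhi _]].
exists b'; split=> // t s t0 s0.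
have := lt0r_neq0 (@sinh_gt0 R (s / 2) (divr_gt0 s0 (ltr0Sn _ 1))) => S0.
by rewrite /Dsinh_half (is_derive_eval (dPhi t s t0 s0)) mulrNN mulKf.
Qed.

(** As sinh s = 2 sinh (s/2) cosh (s/2), this is the previous case up to the
    factor 1/(2 cosh (s/2)), itself an amplitude. *)
Lemma gauss_amplitude_Dsinh Phi b : gauss_amplitude Phi b ->
  exists b', [/\ gauss_amplitude (fun t => Dsinh (Phi t)) b',
    forall t s, 0 < t -> 0 < s ->
      is_derive s 1 (Phi t) (- (sinh s * (gauss t s * b' t s))) &
    forall t s, 0 < t -> 0 < s -> s / (2 * t) * b t s <= sinh s * b' t s].
Proof.
move=> /gauss_amplitude_derivative [b' [ab' dPhi lePhi]].
pose c t s := 2^-1 * (cosh (s / 2))^-1 * b' t s.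
have sc t s : sinh s * c t s = sinh (s / 2) * b' t s.
  rewrite /c sinh_double; have := lt0r_neq0 (cosh_gt0 (s / 2)).
  by move: (cosh _) (sinh _) => C S C0; field.
have dPhi' t s : 0 < t -> 0 < s ->
    is_derive s 1 (Phi t) (- (sinh s * (gauss t s * c t s))).
  by move=> t0 s0; rewrite mulrCA sc mulrCA; exact: dPhi.
exists c; split=> [|//|t s t0 s0]; last by rewrite sc lePhi.
split.
  apply: (amplitude_mul _ ab'); apply: amplitude_mul;
    last exact: amplitude_sech.
  by apply: amplitude_const; rewrite invr_ge0.
move=> t s t0 s0; have S0 := lt0r_neq0 (sinh_gt0 s0).
by rewrite /Dsinh (is_derive_eval (dPhi' t s t0 s0)) mulrNN mulKf.
Qed.

Lemma gauss_amplitude_iter p q : exists b,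
  gauss_amplitude
    (fun t => iter q (@Dsinh R) (iter p (@Dsinh_half R) (gauss t))) b.
Proof.
elim: q => [|q [b /gauss_amplitude_Dsinh [b' [H _ _]]]]; last by exists b'.
elim: p => [|p [b /gauss_amplitude_Dsinh_half [b' H]]]; last by exists b'.
exists (fun _ _ => 1); split; first exact: amplitude_const.
by move=> t s _ _; rewrite mulr1.
Qed.

Lemma gauss_amplitude_time_derivative Phi b : gauss_amplitude Phi b ->
  exists N : nat, exists2 b', amplitude b' & forall t s, 0 < t -> 0 < s ->
    is_derive t 1 (Phi^~ s)
      (s ^+ 2 / (4 * t ^+ 2) * Phi t s - gauss t s * b' t s)
    /\ gauss t s * b' t s <= N%:R / t * Phi t s.
Proof.
move=> [ab E]; have [N [b' ab' db]] := amplitude_time_derivative ab.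
exists N, b' => // t s t0 s0; have [dt le_b'] := db t s t0 s0; split.
  apply: (is_derive_pos_eq t0 (f := fun u => gauss u s * b u s)).
    by move=> u u0; rewrite E.
  apply: is_derive_to (is_derive_mul (is_derive_gauss_time s t0) dt) _.
  by rewrite E//; move: (gauss t s) (s ^+ 2 / _) => g q; ring.
rewrite E// mulrCA; apply: ler_wpM2l; first exact/ltW/gauss_gt0.
by rewrite mulrAC ler_pdivlMr// mulrC.
Qed.

End GaussianAmplitudes.

(** * The factors that depend on time only *)
Section TimePrefactor.
Context {R : realType}.

(** The term - Q^2/4 must be paired with q before taking absolute values; the
    factor t^(-1/2) costs 1/(2t), which goes into the second term. *)
Lemma time_prefactor_bound (A Q K q t dX : R) (X : R -> R) :
  0 <= A -> 0 <= K -> 0 < t -> 0 <= X t ->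
  is_derive t 1 X dX -> `|dX - q * X t| <= K / t * X t ->
  let h u := A * u `^ (- (1 / 2)) * expR (- (Q ^+ 2 * u / 4)) * X u in
  derivable h t 1 /\
  `|h^`()%classic t| <= (K + 1) * (`|q - Q ^+ 2 / 4| + 1 / t) * h t.
Proof.
move=> A0 K0 t0 X0 dtX leX h; have tn0 := lt0r_neq0 t0.
have dpow : is_derive t 1 (fun u : R => u `^ (- (1 / 2)))
    (- (1 / 2) * (t `^ (- (1 / 2)) / t)).
  have := is_derive1_powR (- (1 / 2)) t0.
  by rewrite powRB ?(negbTE tn0) ?implybT// powRr1// ltW.
have dexp : is_derive t 1 (fun u : R => expR (- (Q ^+ 2 * u / 4)))
    (- (Q ^+ 2 / 4) * expR (- (Q ^+ 2 * t / 4))).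
  have E u : - (Q ^+ 2 * u / 4) = - (Q ^+ 2 / 4) * u by ring.
  rewrite (_ : (fun u : R => _) = (fun u => expR (- (Q ^+ 2 / 4) * u)));
    last first.
    by apply/funext => u; rewrite E.
  apply: is_derive_to
    (@is_derive_comp _ expR (fun u => - (Q ^+ 2 / 4) * u) _ _ _
    (is_derive_expR _) (is_derive_scale _ (is_derive_var t))) _.
  by rewrite -E; ring.
pose w := A * t `^ (- (1 / 2)) * expR (- (Q ^+ 2 * t / 4)).
have w0 : 0 <= w by rewrite !mulr_ge0 ?powR_ge0 ?expR_ge0.
have dh : is_derive t 1 h
    (w * ((dX - q * X t) + (q - Q ^+ 2 / 4) * X t - (1 / 2) * (X t / t))).
  apply: is_derive_to (is_derive_mul
    (is_derive_mul (is_derive_scale A dpow) dexp) dtX) _.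
  by rewrite /w; move: (expR _) (t `^ _) => e p; ring.
split; first by case: dh.
rewrite (is_derive_eval dh) normrM (ger0_norm w0) -/w /h -/w.
rewrite [leRHS]mulrC -[leRHS]mulrA ler_wpM2l//.
have Xt0 : 0 <= X t / t by rewrite divr_ge0// ltW.
apply: (le_trans (ler_normB _ _));
  apply: (le_trans (lerD (ler_normD _ _) (lexx _))).
rewrite normrM (ger0_norm X0) [X in _ + X]ger0_norm; last by rewrite mulr_ge0.
move: leX; rewrite mulrAC -mulrA [K * _]mulrC.
have := normr_ge0 (q - Q ^+ 2 / 4); move: `|q - _| => p p0 leX.
rewrite mulrDl mulrDr mul1r.
have := mulr_ge0 p0 X0; have := mulr_ge0 K0 (mulr_ge0 p0 X0).
have := mulr_ge0 K0 Xt0.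
nra.
Qed.

End TimePrefactor.

(** * Integrals over a half-line open at its endpoint *)
Section HalfLineIntegral.
Context {R : realType}.
Notation mu := (@lebesgue_measure R).
Variable r : R.
Implicit Types (f g G : R -> R) (a b s : R).

Definition continuous_above f := forall s, r < s -> {for s, continuous f}.

Lemma continuous_above_sub f g : continuous_above f -> continuous_above g ->
  continuous_above (fun s => f s - g s).
Proof. by move=> cf cg s rs; exact: continuousB (cf s rs) (cg s rs). Qed.

Lemma continuous_above_mul f g : continuous_above f -> continuous_above g ->
  continuous_above (fun s => f s * g s).
Proof. by move=> cf cg s rs; exact: continuousM (cf s rs) (cg s rs). Qed.

Lemma continuous_above_inv f : continuous_above f ->
  (forall s, r < s -> f s != 0) -> continuous_above (fun s => (f s)^-1).
Proof. by move=> cf f0 s rs; exact: continuousV (f0 s rs) (cf s rs). Qed.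

Lemma continuous_above_cst (c : R) : continuous_above (fun _ => c).
Proof. by move=> s _; exact: cst_continuous. Qed.

Lemma continuous_above_var : continuous_above (fun s => s).
Proof. by move=> s _; exact: cvg_id. Qed.

Lemma continuous_above_sqr f : continuous_above f ->
  continuous_above (fun s => f s ^+ 2).
Proof.
move=> cf; rewrite (_ : (fun s => _) = fun s => f s * f s) //.
exact: continuous_above_mul.
Qed.

Lemma continuous_above_derive f (f' : R -> R) :
  (forall s, r < s -> is_derive s 1 f (f' s)) -> continuous_above f.
Proof. by move=> df s rs; exact: is_derive_cont (df s rs). Qed.

Lemma continuous_above_within f a b : r < a -> continuous_above f ->
  {within `[a, b], continuous f}.
Proof.
move=> ra cf; apply: continuous_in_subspaceT => s.
rewrite inE/= in_itv/= => /andP[+ _]; move=> /(lt_le_trans ra); exact: cf.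
Qed.

Lemma continuous_above_integrable f a b : r < a -> continuous_above f ->
  mu.-integrable `[a, b] (EFin \o f).
Proof.
move=> ra cf; apply: continuous_compact_integrable;
  first exact: segment_compact.
exact: continuous_above_within.
Qed.

Lemma continuous_above_measurable f : continuous_above f ->
  measurable_fun `]r, +oo[ f.
Proof.
move=> cf; apply: open_continuous_measurable_fun => //.
by move=> s; rewrite inE/= in_itv/= andbT; exact: cf.
Qed.

Lemma Rintegral_derivative G g a b : r < a -> a < b ->
  (forall s, r < s -> is_derive s 1 G (g s)) -> continuous_above g ->
  \int[mu]_(s in `[a, b]) g s = G b - G a.
Proof.
move=> ra ab dG cg; rewrite /Rintegral.
rewrite (@continuous_FTC2 R g G a b ab (continuous_above_within ra cg))//.
- split => [s||].
  + by rewrite in_itv/= => /andP[lt_as _]; have [] := dG s (lt_trans ra lt_as).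
  + by apply: cvg_at_right_filter; exact: is_derive_cont (dG _ ra).
  + by apply: cvg_at_left_filter; exact: is_derive_cont (dG _ (lt_trans ra ab)).
- move=> s; rewrite in_itv/= => /andP[lt_as _].
  exact: is_derive_eval (dG s (lt_trans ra lt_as)).
Qed.

(** The integrands below are singular at r, and only their integrals over
    compact subintervals are computed, through an antiderivative; monotone
    convergence along [r + 1/(n+1), r + n + 2] gives integrability and the bound
    at once. *)
Lemma exhaustion f M : continuous_above f -> (forall s, r < s -> 0 <= f s) ->
  (forall a b, r < a -> a < b -> \int[mu]_(s in `[a, b]) f s <= M) ->
  mu.-integrable `]r, +oo[ (EFin \o f) /\ \int[mu]_(s in `]r, +oo[) f s <= M.
Proof.
move=> cf f0 leM.
have mf := continuous_above_measurable cf.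
pose F (n : nat) : set R := `[r + n.+1%:R^-1, r + n.+2%:R]%classic.
have ltF n : r < r + n.+1%:R^-1 :> R by rewrite ltrDl invr_gt0.
have ltFF n : r + n.+1%:R^-1 < r + n.+2%:R :> R.
  by rewrite ltrD2l (le_lt_trans (_ : _ <= 1)) ?ltr1n// invf_le1// ler1n.
have UF : \bigcup_n F n = `]r, +oo[%classic.
  rewrite eqEsubset; split => [s [n _]|s].
    by rewrite /F/= !in_itv/= andbT => /andP[+ _]; exact: lt_le_trans.
  rewrite /= in_itv/= andbT => rs.
  have sr0 : 0 < s - r by rewrite subr_gt0.
  exists (maxn (Num.truncn (s - r)^-1) (Num.truncn (s - r))) => //.
  rewrite /F/= in_itv/=; apply/andP; split.
    rewrite -lerBrDl invf_ple ?posrE//; apply: (le_trans (ltW (truncnS_gt _))).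
    by rewrite ler_nat ltnS leq_maxl.
  rewrite -lerBlDl; apply: (le_trans (ltW (truncnS_gt _))).
  by rewrite ler_nat ltnS leqW// leq_maxr.
have : (\int[mu]_(x in F i) (f x)%:E)%E @[i --> \oo] -->
    (\int[mu]_(x in `]r, +oo[) (f x)%:E)%E.
  rewrite -UF; apply: ge0_nondecreasing_set_cvg_integral.
  - move=> m n mn; apply/subsetPset => s;
      rewrite /F/= !in_itv/= => /andP[ms sm].
    apply/andP; split.
      by apply: le_trans ms; rewrite lerD2l lef_pV2 ?posrE// ler_nat.
    by apply: (le_trans sm); rewrite lerD2l ler_nat.
  - by move=> n; exact: measurable_itv.
  - by move=> n; case/integrableP: (continuous_above_integrable (r + n.+2%:R)
      (ltF n) cf).
  - move=> n s; rewrite /F/= in_itv/= => /andP[/(lt_le_trans (ltF n)) rs _].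
    by rewrite lee_fin f0.
move=> cvgF.
have leME : (\int[mu]_(x in `]r, +oo[) (f x)%:E <= M%:E)%E.
  rewrite -(cvg_lim _ cvgF)//; apply: lime_le; first by apply/cvg_ex; eexists;
    exact: cvgF.
  apply: nearW => n.
  have := leM _ _ (ltF n) (ltFF n); rewrite -lee_fin /Rintegral fineK//.
  exact/integrable_fin_num/continuous_above_integrable.
have f0E : forall s, `]r, +oo[%classic s -> (0 <= (f s)%:E)%E.
  by move=> s; rewrite /= in_itv/= andbT lee_fin; exact: f0.
have intf : mu.-integrable `]r, +oo[ (EFin \o f).
  apply/integrableP; split; first exact/measurable_EFinP.
  apply: (le_lt_trans _ (le_lt_trans leME (ltry M))).
  rewrite le_eqVlt; apply/orP; left; apply/eqP; apply: eq_integral.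
  by move=> s; rewrite inE => /f0E fs; rewrite /= ger0_norm// -lee_fin.
split=> //; rewrite -lee_fin /Rintegral fineK//; exact: integrable_fin_num.
Qed.

Lemma ge0_Rintegral_subset f (A B : set R) : measurable A -> measurable B ->
  A `<=` B -> (forall s, B s -> 0 <= f s) -> mu.-integrable B (EFin \o f) ->
  \int[mu]_(s in A) f s <= \int[mu]_(s in B) f s.
Proof.
move=> mA mB AB f0 intf; rewrite /Rintegral fine_le//.
- by apply: integrable_fin_num => //; apply: integrableS intf.
- exact: integrable_fin_num.
- by apply: ge0_subset_integral => //; case/integrableP: intf.
Qed.

Lemma integrable_scale c f : mu.-integrable `]r, +oo[ (EFin \o f) ->
  mu.-integrable `]r, +oo[ (EFin \o (fun s => c * f s)).
Proof.
move=> intf.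
have -> : EFin \o (fun s => c * f s) = (fun s => c%:E * (EFin \o f) s)%E by [].
by apply: integrableZl.
Qed.

Lemma integrable_add f g : mu.-integrable `]r, +oo[ (EFin \o f) ->
  mu.-integrable `]r, +oo[ (EFin \o g) ->
  mu.-integrable `]r, +oo[ (EFin \o (fun s => f s + g s)).
Proof.
move=> intf intg.
have -> : EFin \o (fun s => f s + g s) = ((EFin \o f) \+ (EFin \o g))%E by [].
by apply: integrableD.
Qed.

Lemma integrable_sub f g : mu.-integrable `]r, +oo[ (EFin \o f) ->
  mu.-integrable `]r, +oo[ (EFin \o g) ->
  mu.-integrable `]r, +oo[ (EFin \o (fun s => f s - g s)).
Proof.
move=> intf intg.
have -> : EFin \o (fun s => f s - g s) = ((EFin \o f) \- (EFin \o g))%E by [].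
by apply: integrableB.
Qed.

Lemma continuous_dominated_integrable f g : continuous_above f ->
  (forall s, r < s -> `|f s| <= g s) ->
  mu.-integrable `]r, +oo[ (EFin \o g) -> mu.-integrable `]r, +oo[ (EFin \o f).
Proof.
move=> cf fg; apply: le_integrable => //.
- by apply/measurable_EFinP; exact: continuous_above_measurable cf.
- move=> s; rewrite /= in_itv/= andbT => rs.
  by rewrite lee_fin (le_trans (fg s rs))// ler_norm.
Qed.

End HalfLineIntegral.

(** * The Abel kernel *)
Section AbelKernel.
Context {R : realType}.
Notation mu := (@lebesgue_measure R).
Context (r : R) (r0 : 0 < r).
Implicit Types (s t : R).

Definition root_gap s := Num.sqrt (cosh s - cosh r).
Definition abel_kernel s := sinh s / root_gap s.
(** The derivative of - 1/(1 + root_gap), hence integrable; it has the same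
    singularity at r as the kernel and decays exponentially at infinity. *)
Definition abel_majorant s := sinh s / (2 * root_gap s) / (1 + root_gap s) ^+ 2.

Lemma root_gap_gt0 s : r < s -> 0 < root_gap s.
Proof. by move=> rs; rewrite sqrtr_gt0 subr_gt0 ltr_cosh// ltW. Qed.

Lemma root_gap_sqr s : r <= s -> root_gap s ^+ 2 = cosh s - cosh r.
Proof. by move=> rs; rewrite sqr_sqrtr// subr_ge0 ler_cosh// ltW. Qed.

Lemma is_derive_root_gap s : r < s ->
  is_derive s 1 root_gap (sinh s / (2 * root_gap s)).
Proof.
move=> rs; have gap0 : 0 < cosh s - cosh r by rewrite subr_gt0 ltr_cosh// ltW.
apply: is_derive_to (@is_derive_comp _ Num.sqrt (fun y => cosh y - cosh r) _ _ _
  (is_derive1_sqrt gap0) (is_derive_sub (is_derive_cosh s)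
    (is_derive_const _ s))) _.
by rewrite subr0 mulrC.
Qed.

Lemma continuous_above_sinh : continuous_above r (@sinh R).
Proof. exact: continuous_above_derive (fun s _ => is_derive_sinh s). Qed.

Lemma continuous_above_root_gap_inv :
  continuous_above r (fun s => (root_gap s)^-1).
Proof.
apply: continuous_above_inv (continuous_above_derive is_derive_root_gap) _.
by move=> s /root_gap_gt0/lt0r_neq0.
Qed.

Lemma continuous_above_abel_kernel : continuous_above r abel_kernel.
Proof.
exact: continuous_above_mul continuous_above_sinh continuous_above_root_gap_inv.
Qed.

Lemma abel_kernel_ge0 s : r < s -> 0 <= abel_kernel s.
Proof.
move=> rs; rewrite divr_ge0 ?(ltW (root_gap_gt0 rs))// sinh_ge0// ltW//.
exact: lt_trans rs.
Qed.

Lemma abel_majorant_ge0 s : r < s -> 0 <= abel_majorant s.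
Proof.
move=> rs; have g0 := ltW (root_gap_gt0 rs).
have S0 := sinh_ge0 (ltW (lt_trans r0 rs)).
by apply: divr_ge0 (sqr_ge0 _); apply: divr_ge0 => //; exact: mulr_ge0.
Qed.

Lemma abel_majorant_integrable :
  mu.-integrable `]r, +oo[ (EFin \o abel_majorant).
Proof.
have dom : continuous_above r (fun s => 1 + root_gap s).
  apply: continuous_above_derive => s rs.
  exact: is_derive_add (is_derive_const 1 s) (is_derive_root_gap rs).
have g1 s : 0 < 1 + root_gap s by rewrite ltr_pwDl// sqrtr_ge0.
have cm : continuous_above r abel_majorant.
  apply: continuous_above_mul.
    apply: continuous_above_mul continuous_above_sinh _.
    rewrite (_ : (fun s => _) = fun s => 2^-1 * (root_gap s)^-1); last first.
      by apply/funext => s; rewrite invfM.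
    by apply: continuous_above_mul;
      [exact: continuous_above_cst | exact: continuous_above_root_gap_inv].
  apply: continuous_above_inv => [|s _]; last exact/lt0r_neq0/exprn_gt0.
  exact: continuous_above_sqr.
apply: (proj1 (@exhaustion _ r _ 1 cm abel_majorant_ge0 _)) => a b ra ab.
have dG s : r < s ->
    is_derive s 1 (fun y => - (1 + root_gap y)^-1) (abel_majorant s).
  move=> rs.
  have := is_derive_inv (f := fun y => 1 + root_gap y) (lt0r_neq0 (g1 s))
    (is_derive_add (is_derive_const 1 s) (is_derive_root_gap rs)).
  move=> /is_deriveN/is_derive_to; apply.
  by rewrite /abel_majorant add0r mulNr opprK.
rewrite (Rintegral_derivative ra ab dG cm) opprK addrC.
have : 0 <= (1 + root_gap b)^-1 by rewrite invr_ge0 ltW.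
have : (1 + root_gap a)^-1 <= 1 by rewrite invf_le1// lerDl sqrtr_ge0.
by lra.
Qed.

(** The quotient of the kernel by its majorant is 2 (1 + root_gap s)^2 <= 4 e^s
    and 1 + s^2 <= 5 e^s, while e^(2s) times the Gaussian is at most e^(4t), by
    completing the square.  The factor 1 + s^2 covers both the integrand and its
    derivative in t. *)
Lemma gauss_abel_kernel_le t s : 0 < t -> r < s ->
  gauss t s * (1 + s ^+ 2) * abel_kernel s <=
  20 * expR (4 * t) * abel_majorant s.
Proof.
move=> t0 rs; have s0 := lt_trans r0 rs; have g0 := root_gap_gt0 rs.
have m0 := abel_majorant_ge0 rs.
have -> : abel_kernel s = 2 * (1 + root_gap s) ^+ 2 * abel_majorant s.
  rewrite /abel_majorant /abel_kernel; field.
  by rewrite !lt0r_neq0// ltr_pwDl// ltW.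
rewrite mulrA; apply: ler_wpM2r => //.
have gap_le : 2 * (1 + root_gap s) ^+ 2 <= 4 * expR s.
  have := root_gap_sqr (ltW rs).
  have := ler_cosh (lexx 0) (ltW r0);
    rewrite {1}/cosh oppr0 expR0 -mulr2n divff ?pnatr_eq0//.
  have : cosh s <= expR s.
    have : expR (- s) <= expR s by rewrite ler_expR; lra.
    by rewrite /cosh; lra.
  have := sqr_ge0 (1 - root_gap s).
  by move: (root_gap s) => g; nra.
have sq_le : 1 + s ^+ 2 <= 5 * expR s.
  have := expR_ge1Dx (s / 2); have := expR_ge1Dx s.
  have -> : expR s = expR (s / 2) ^+ 2 by rewrite expr2 -expRD -splitr.
  move: (expR _) => e h1 h2; nra.
have exp_le : gauss t s * (expR s * expR s) <= expR (4 * t).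
  rewrite /gauss -!expRD ler_expR -subr_ge0.
  have -> : 4 * t - (- (s ^+ 2 / (4 * t)) + (s + s)) =
      (s - 4 * t) ^+ 2 / (4 * t).
    by field; exact: lt0r_neq0.
  by rewrite divr_ge0 ?sqr_ge0// mulr_ge0// ltW.
have G0 := gauss_gt0 t s.
apply: (@le_trans _ _ (gauss t s * (5 * expR s) * (4 * expR s))).
  apply: ler_pM => //.
  - by rewrite mulr_ge0 ?addr_ge0 ?sqr_ge0// ltW.
  - by rewrite mulr_ge0 ?sqr_ge0.
  - by rewrite ler_wpM2l// ltW.
have -> : gauss t s * (5 * expR s) * (4 * expR s) =
  20 * (gauss t s * (expR s * expR s)) by ring.
by rewrite ler_wpM2l.
Qed.

(** With H = (s^2 - r^2) B / root_gap, the derivative of H is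
    2 s B / root_gap - (s^2 - r^2) k P plus a nonpositive term, the last one
    coming from the derivative of 1 / root_gap.  By the assumed lower bound on
    sinh s * P the first term is at most 4 t k P, so that
    (s^2 - r^2) k P <= 4 t k P - H'.  It remains to integrate: H is nonnegative
    at the upper end, and it tends to 0 at r because
    s^2 - r^2 <= 2 root_gap^2. *)
Lemma excess_integral_le (B P : R -> R) M t :
  0 < t -> continuous_above r P ->
  (forall s, r < s -> is_derive s 1 B (- (sinh s * P s))) ->
  (forall s, r < s -> 0 <= B s <= M) ->
  (forall s, r < s -> s / (2 * t) * B s <= sinh s * P s) ->
  mu.-integrable `]r, +oo[ (EFin \o (fun s => abel_kernel s * P s)) ->
  mu.-integrable `]r, +oo[
    (EFin \o (fun s => (s ^+ 2 - r ^+ 2) * (abel_kernel s * P s))) /\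
  \int[mu]_(s in `]r, +oo[) ((s ^+ 2 - r ^+ 2) * (abel_kernel s * P s)) <=
  4 * t * \int[mu]_(s in `]r, +oo[) (abel_kernel s * P s).
Proof.
move=> t0 cP dB B0M leBP intP.
have M0 : 0 <= M.
  by have /andP[] := B0M (r + 1) (ltr_pwDr ltr01 (lexx r)); exact: le_trans.
have pos s : r < s -> 0 < s by exact: lt_trans.
have sq0 s : r < s -> 0 <= s ^+ 2 - r ^+ 2.
  by move=> rs; rewrite subr_ge0 lerXn2r ?nnegrE ?(ltW r0) ?(ltW
    (pos s rs)) ?ltW.
have P0 s : r < s -> 0 <= P s.
  move=> rs; rewrite -(pmulr_rge0 _ (sinh_gt0 (pos _ rs))).
  apply: le_trans (leBP s rs); apply: mulr_ge0;
    last by have /andP[] := B0M s rs.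
  by apply: divr_ge0; [exact/ltW/pos | rewrite mulr_ge0// ltW].
have cB := continuous_above_derive dB.
have cvar := @continuous_above_var R r; have cst := @continuous_above_cst R r.
have csq : continuous_above r (fun s => s ^+ 2 - r ^+ 2).
  by apply: continuous_above_sub; [exact: continuous_above_sqr | exact: cst].
have crg := continuous_above_root_gap_inv.
have ck := continuous_above_abel_kernel.
have ckP := continuous_above_mul ck cP.
have cskP := continuous_above_mul csq ckP.
pose H s := (s ^+ 2 - r ^+ 2) * (B s * (root_gap s)^-1).
pose H' s := 2 * s * (B s * (root_gap s)^-1) - (s ^+ 2 - r ^+ 2) *
  (abel_kernel s * P s) - (s ^+ 2 - r ^+ 2) * (B s * (2^-1 *
    (abel_kernel s * ((root_gap s)^-1 * (root_gap s)^-1)))).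
have dH s : r < s -> is_derive s 1 H (H' s).
  move=> rs; have g0 := lt0r_neq0 (root_gap_gt0 rs).
  apply: is_derive_to (is_derive_mul
    (is_derive_sub (is_derive_exp 2 (is_derive_var s)) (is_derive_const
      (r ^+ 2) s))
    (is_derive_mul (dB s rs) (is_derive_inv g0 (is_derive_root_gap rs)))) _.
  rewrite /H' /abel_kernel /=;
    move: (root_gap s) g0 (sinh s) (B s) (P s) => g g0 S b p.
  by field.
have cH' : continuous_above r H'.
  apply: continuous_above_sub.
    by apply: continuous_above_sub => //;
      do 2 (apply: continuous_above_mul => //).
  do 2 (apply: continuous_above_mul => //).
  by do 3 (apply: continuous_above_mul => //).
have leH s : r < s ->
    (s ^+ 2 - r ^+ 2) * (abel_kernel s * P s) <=
    4 * t * (abel_kernel s * P s) - H' s.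
  move=> rs; have g0 := root_gap_gt0 rs; rewrite /H'.
  have /andP[Bs0 _] := B0M s rs.
  have : 0 <= (s ^+ 2 - r ^+ 2) * (B s * (2^-1 *
    (abel_kernel s * ((root_gap s)^-1 * (root_gap s)^-1)))).
    have k0 := abel_kernel_ge0 rs; have u0 := sq0 s rs.
    have i0 : 0 <= (root_gap s)^-1 by rewrite invr_ge0 ltW.
    have h0 : 0 <= 2^-1 :> R by rewrite invr_ge0.
    by do 2 (apply: mulr_ge0 => //); do 2 (apply: mulr_ge0 => //);
      exact: mulr_ge0.
  have : 2 * s * (B s * (root_gap s)^-1) <= 4 * t * (abel_kernel s * P s).
    have -> : 2 * s * (B s * (root_gap s)^-1) =
        4 * t / root_gap s * (s / (2 * t) * B s).
      by field; rewrite !lt0r_neq0.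
    have -> : 4 * t * (abel_kernel s * P s) =
        4 * t / root_gap s * (sinh s * P s).
      by rewrite /abel_kernel; field; rewrite lt0r_neq0.
    by rewrite ler_wpM2l ?leBP// divr_ge0 ?mulr_ge0 ?ltW.
  by lra.
have H0 s : r < s -> 0 <= H s.
  move=> rs; rewrite !mulr_ge0 ?sq0 ?invr_ge0 ?(ltW (root_gap_gt0 rs))//.
  by have /andP[] := B0M s rs.
have leHM s : r < s -> H s <= 2 * M * root_gap s.
  move=> rs; have g0 := root_gap_gt0 rs; have /andP[Bs0 BsM] := B0M s rs.
  have gap := half_sqr_sub_le_cosh_sub (ltW r0) (ltW rs).
  rewrite -(root_gap_sqr (ltW rs)) in gap.
  rewrite /H mulrA ler_pdivrMr//.
  have -> : 2 * M * root_gap s * root_gap s = 2 * root_gap s ^+ 2 * M by ring.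
  by apply: ler_pM => //; exact: sq0.
have subset_above a b : r < a -> ([set` `[a, b]] : set R) `<=` [set` `]r, +oo[].
  by move=> ra s; rewrite /= !in_itv/= andbT => /andP[+ _]; exact: lt_le_trans.
have above (f : R -> R) : (forall s, r < s -> 0 <= f s) ->
    forall s, [set` `]r, +oo[] s -> 0 <= f s.
  by move=> f0 s; rewrite /= in_itv/= andbT; exact: f0.
set J := \int[mu]_(s in `]r, +oo[) (abel_kernel s * P s).
have kP0 s : r < s -> 0 <= abel_kernel s * P s.
  by move=> rs; rewrite mulr_ge0 ?abel_kernel_ge0 ?P0.
have skP0 s : r < s -> 0 <= (s ^+ 2 - r ^+ 2) * (abel_kernel s * P s).
  by move=> rs; rewrite mulr_ge0 ?sq0 ?kP0.
have le_ab a b : r < a -> a < b ->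
    \int[mu]_(s in `[a, b]) ((s ^+ 2 - r ^+ 2) * (abel_kernel s * P s)) <=
    4 * t * J + H a.
  move=> ra ab.
  have c4 : continuous_above r (fun s => 4 * t * (abel_kernel s * P s)).
    exact: continuous_above_mul.
  apply: (@le_trans _ _
    (\int[mu]_(s in `[a, b]) (4 * t * (abel_kernel s * P s) - H' s))).
    apply: le_Rintegral => //.
    - exact: continuous_above_integrable _ _ cskP.
    - exact: continuous_above_integrable _ _ (continuous_above_sub c4 cH').
    - by move=> s; rewrite /= in_itv/= => /andP[+ _] => /(lt_le_trans ra)/leH.
  rewrite RintegralB//; [|exact: continuous_above_integrable _ _ c4
                         |exact: continuous_above_integrable _ _ cH'].
  rewrite (Rintegral_derivative ra ab dH cH') RintegralZl//; last first.
    exact: continuous_above_integrable _ _ ckP.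
  have := ge0_Rintegral_subset (measurable_itv `[a, b])
    (measurable_itv `]r, +oo[)
    (subset_above _ _ ra) (above _ kP0) intP.
  have := H0 b (lt_trans ra ab); rewrite -/J => Hb0 le.
  have t40 : 0 <= 4 * t by rewrite mulr_ge0// ltW.
  by have := ler_wpM2l t40 le; lra.
have le_eps e : 0 < e -> forall a b, r < a -> a < b ->
    \int[mu]_(s in `[a, b]) ((s ^+ 2 - r ^+ 2) * (abel_kernel s * P s)) <=
    4 * t * J + e.
  move=> e0 a b ra ab.
  have [a' [ra' aa' Ha']] : exists a', [/\ r < a', a' < a & H a' <= e].
    have cv : {for r, continuous (fun s => 2 * M * root_gap s)}.
      apply: continuousM; first exact: cst_continuous.
      apply: (@continuous_comp _ _ _ (fun s => cosh s - cosh r) Num.sqrt).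
        exact: is_derive_cont (is_derive_sub (is_derive_cosh r)
          (is_derive_const _ r)).
      exact: sqrt_continuous.
    have cv0 : 2 * M * root_gap s @[s --> r^'+] --> (0 : R).
      have := cvg_at_right_filter cv.
      by rewrite {2}/root_gap subrr sqrtr0 mulr0.
    have : \forall a' \near r^'+, [/\ r < a', a' < a & H a' <= e].
      near=> x.
      have rx : r < x by near: x; exact: nbhs_right_gt.
      split; [exact: rx | by near: x; exact: nbhs_right_lt |].
      apply: (le_trans (leHM _ rx)); rewrite ltW//.
      by near: x; exact: (cvgr_lt _ cv0).
    by move/filter_ex.
  apply: (@le_trans _ _ (4 * t * J + H a')); last by rewrite lerD2l.
  apply: le_trans (le_ab a' b ra' (lt_trans aa' ab)).
  apply: ge0_Rintegral_subset => //.
  - by move=> s; rewrite /= !in_itv/= => /andP[/(le_trans (ltW aa')) ->].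
  - by move=> s /(subset_above _ _ ra')/(above _ skP0).
  - exact: continuous_above_integrable _ _ cskP.
split; first exact: (proj1 (exhaustion cskP skP0 (le_eps 1 ltr01))).
by apply/ler_addgt0Pr => e e0;
  exact: (proj2 (exhaustion cskP skP0 (le_eps e e0))).
Unshelve. all: by end_near. Qed.

End AbelKernel.

(** * The Abel transform of a Gaussian times an amplitude *)
Section AbelTransformOfAmplitude.
Context {R : realType}.
Notation mu := (@lebesgue_measure R).

(** The derivative of the integrand in t is s^2/(4t^2) times it, minus a term
    bounded by a multiple of 1/t times it.  Replacing s^2 by r^2 costs one more
    1/t, by excess_integral_le. *)
Lemma abel_transform_time_derivative (Phi bPhi : R -> R -> R) :
  gauss_amplitude Phi bPhi ->
  exists N : nat, forall r t, 0 < r -> 0 < t ->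
    let F u := \int[mu]_(s in `]r, +oo[) (abel_kernel r s * Dsinh (Phi u) s) in
    0 <= F t /\ exists2 dF, is_derive t 1 F dF &
      `|dF - r ^+ 2 / (4 * t ^+ 2) * F t| <= N%:R / t * F t.
Proof.
move=> HPhi; have [b [HP dPhi lePhi]] := gauss_amplitude_Dsinh HPhi.
have [N [b' ab' dtP]] := gauss_amplitude_time_derivative HP.
have [aPhi EPhi] := HPhi; have [ab EP'] := HP.
have EP (u s : R) : 0 < u -> 0 < s ->
    Dsinh (Phi u) s = gauss u s * b u s by exact: EP'.
exists N.+1 => r t r0 t0 F.
have half0 : 0 < t / 2 by rewrite divr_gt0.
have tn0 := lt0r_neq0 t0.
have pos (s : R) : r < s -> 0 < s by exact: lt_trans.
pose f u s := abel_kernel r s * Dsinh (Phi u) s.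
pose f1 u s := abel_kernel r s *
  (s ^+ 2 / (4 * u ^+ 2) * Dsinh (Phi u) s - gauss u s * b' u s).
have cP (u : R) : 0 < u -> continuous_above r (Dsinh (Phi u)).
  move=> u0; have [b2 [_ d2 _]] := gauss_amplitude_derivative HP.
  exact: continuous_above_derive (fun s rs => d2 u s u0 (pos s rs)).
have P0 (u s : R) : 0 < u -> r < s -> 0 <= Dsinh (Phi u) s.
  move=> u0 rs; have s0 := pos s rs;
    rewrite EP// mulr_ge0 ?(amplitude_ge0 ab)//.
  exact/ltW/gauss_gt0.
have ck := continuous_above_abel_kernel r0.
have cf (u : R) : 0 < u -> continuous_above r (f u).
  by move=> u0; exact: continuous_above_mul ck (cP u u0).
have f0 (u s : R) : 0 < u -> r < s -> 0 <= f u s.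
  by move=> u0 rs; rewrite mulr_ge0 ?(abel_kernel_ge0 r0)// P0.
have g1 (u s : R) : 0 < u -> r < s -> forall c d, 0 <= c -> 0 <= d ->
    abel_kernel r s * (gauss u s * (s ^+ 2 * c + d)) <=
    20 * expR (4 * u) * (c + d) * abel_majorant r s.
  move=> u0 rs c d c0 d0.
  have := gauss_abel_kernel_le r0 u0 rs => le1.
  have cd0 : 0 <= c + d by exact: addr_ge0.
  have le2 := ler_wpM2r cd0 le1; rewrite [leRHS]mulrAC; apply: le_trans le2.
  have -> : gauss u s * (1 + s ^+ 2) * abel_kernel r s * (c + d) =
    abel_kernel r s * (gauss u s * ((1 + s ^+ 2) * (c + d))) by ring.
  rewrite ler_wpM2l ?(abel_kernel_ge0 r0)// ler_wpM2l ?(ltW (gauss_gt0 _ _))//.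
  by have := sqr_ge0 s; nra.
have intf (u : R) : 0 < u -> mu.-integrable `]r, +oo[ (EFin \o f u).
  move=> u0.
  apply: continuous_dominated_integrable (cf u u0) _
    (integrable_scale (20 * expR (4 * u) * b u r)
      (abel_majorant_integrable r0)).
  move=> s rs; rewrite ger0_norm ?f0//.
  have := g1 u s u0 rs 0 (b u r) (lexx 0) (amplitude_ge0 ab u0 r0).
  rewrite mulr0 !add0r; apply: le_trans; rewrite /f EP ?(pos s rs)//.
  rewrite ler_wpM2l ?(abel_kernel_ge0 r0)// ler_wpM2l ?(ltW (gauss_gt0 _ _))//.
  exact: amplitude_nincr_space (ltW rs).
(* On this window amplitudes are largest at (t/2, r) and exp(4u) at u = 2t, so
   one integrable function dominates the derivatives in time. *)
pose I : set R := `]t / 2, 2 * t[%classic.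
have I0 (u : R) : I u -> 0 < u.
  by rewrite /I/= in_itv/= => /andP[+ _]; exact: lt_trans.
pose M := 20 * expR (4 * (2 * t)) * ((t ^+ 2)^-1 * b (t / 2) r + b' (t / 2) r).
have M0 : 0 <= M.
  rewrite !mulr_ge0 ?expR_ge0// addr_ge0 ?mulr_ge0 ?invr_ge0 ?sqr_ge0//.
    exact: amplitude_ge0.
  exact: amplitude_ge0.
have f1M (u s : R) : I u -> r < s -> `|f1 u s| <= M * `|abel_majorant r s|.
  move=> Iu rs; have u0 := I0 u Iu; have s0 := pos s rs.
  have un0 := lt0r_neq0 u0.
  rewrite (ger0_norm (abel_majorant_ge0 r0 rs)).
  have bu0 := amplitude_ge0 ab u0 s0; have b'u0 := amplitude_ge0 ab' u0 s0.
  have i0 : 0 <= (4 * u ^+ 2)^-1 by rewrite invr_ge0 mulr_ge0 ?sqr_ge0.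
  apply: (@le_trans _ _ (abel_kernel r s *
      (gauss u s * (s ^+ 2 * ((4 * u ^+ 2)^-1 * b u s) + b' u s)))).
    rewrite /f1 EP// normrM (ger0_norm (abel_kernel_ge0 r0 rs)).
    rewrite ler_wpM2l ?(abel_kernel_ge0 r0)//.
    have -> : s ^+ 2 / (4 * u ^+ 2) * (gauss u s * b u s) - gauss u s * b' u s =
      gauss u s * (s ^+ 2 * ((4 * u ^+ 2)^-1 * b u s) - b' u s) by ring.
    rewrite normrM (ger0_norm (ltW (gauss_gt0 _ _))) ler_wpM2l ?(ltW
      (gauss_gt0 _ _))//.
    apply: le_trans (ler_normB _ _) _; rewrite [X in _ + X]ger0_norm//.
    by rewrite ger0_norm// mulr_ge0 ?sqr_ge0// mulr_ge0.
  apply: le_trans (g1 u s u0 rs _ _ (mulr_ge0 i0 bu0) b'u0) _.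
  rewrite ler_wpM2r ?(abel_majorant_ge0 r0)//.
  move: Iu; rewrite /I/= in_itv/= => /andP[tu ut].
  have le_b c : amplitude c -> c u s <= c (t / 2) r.
    move=> ac; apply: le_trans (amplitude_nincr_time ac half0 s0 (ltW tu)) _.
    exact: amplitude_nincr_space (ltW rs).
  apply: ler_pM.
  - by rewrite mulr_ge0 ?expR_ge0.
  - by rewrite addr_ge0 ?mulr_ge0.
  - by rewrite ler_wpM2l// ler_expR ler_wpM2l// ltW.
  - rewrite lerD ?le_b// ler_pM ?le_b// lef_pV2 ?posrE ?mulr_gt0 ?exprn_gt0//.
    by nra.
have df (u s : R) : I u -> r < s -> is_derive u 1 (f^~ s) (f1 u s).
  move=> Iu rs; have [d _] := dtP u s (I0 u Iu) (pos s rs).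
  exact: is_derive_scale.
have It : I t by rewrite /I/= in_itv/=; lra.
pose G s := M * `|abel_majorant r s|.
have G0 (s : R) : 0 <= G s by rewrite mulr_ge0.
have intG : mu.-integrable `]r, +oo[ (EFin \o G).
  apply: integrable_scale.
  by apply: integrable_norm; exact: abel_majorant_integrable.
have part (u s : R) : I u -> r < s -> partial1of2 f u s = f1 u s.
  by move=> Iu rs; rewrite /partial1of2 (is_derive_eval (df u s Iu rs)).
have Drs (s : R) : `]r, +oo[%classic s -> r < s by rewrite /= in_itv/= andbT.
have dFt : is_derive t 1 F (\int[mu]_(s in `]r, +oo[) f1 t s).
  have h1 (u : R) : I u -> mu.-integrable `]r, +oo[ (EFin \o f u).
    by move=> /I0; exact: intf.
  have h2 (u s : R) : I u -> `]r, +oo[%classic s -> derivable (f^~ s) u 1.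
    by move=> Iu /Drs rs; case: (df u s Iu rs).
  have h3 (u s : R) : I u -> `]r, +oo[%classic s -> `|partial1of2 f u s| <= G s.
    by move=> Iu /Drs rs; rewrite part//; exact: f1M.
  have mD := measurable_itv `]r, +oo[.
  have dF := @derivable_under_integral R _ _ mu f _ mD t _ _ It h1 h2 G G0
    intG h3.
  have eF := @differentiation_under_integral R _ _ mu f _ mD t _ _ It h1 h2 G
    G0 intG h3.
  apply: is_derive_to (derivableP dF) _; rewrite -derive1E eF.
  by apply: eq_Rintegral => s; rewrite inE => /Drs rs; rewrite part.
have cf1 : continuous_above r (f1 t).
  apply: continuous_above_mul ck _; apply: continuous_above_sub.
    apply: continuous_above_mul (cP t t0).
    apply: continuous_above_mul; last exact: continuous_above_cst.
    by apply: continuous_above_sqr; exact: continuous_above_var.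
  have [b2 _ d2] := amplitude_space_derivative ab'.
  apply: continuous_above_mul.
    exact: continuous_above_derive (fun s rs => is_derive_gauss_space s t0).
  exact: continuous_above_derive (fun s rs => d2 t s t0 (pos s rs)).
have intf1 : mu.-integrable `]r, +oo[ (EFin \o f1 t).
  apply: continuous_dominated_integrable cf1 _ intG => s rs; exact: f1M.
have Ft0 : 0 <= F t by apply: Rintegral_ge0 => s /Drs rs; exact: f0.
split=> //; exists (\int[mu]_(s in `]r, +oo[) f1 t s) => //.
set q : R := r ^+ 2 / (4 * t ^+ 2).
have B0M (s : R) : r < s -> 0 <= Phi t s <= bPhi t r.
  move=> rs; have s0 := pos s rs; rewrite EPhi//.
  have G_ge0 := ltW (gauss_gt0 t s).
  have bs0 := amplitude_ge0 aPhi t0 s0.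
  rewrite mulr_ge0//=; apply: le_trans (amplitude_nincr_space aPhi t0 r0
    (ltW rs)).
  apply: ler_piMl => //; rewrite /gauss -expR0 ler_expR oppr_le0.
  by rewrite divr_ge0 ?sqr_ge0// mulr_ge0// ltW.
have dB (s : R) : r < s ->
    is_derive s 1 (Phi t) (- (sinh s * Dsinh (Phi t) s)).
  by move=> rs; have s0 := pos s rs; rewrite EP//; exact: dPhi.
have leBP (s : R) : r < s -> s / (2 * t) * Phi t s <= sinh s * Dsinh (Phi t) s.
  move=> rs; have s0 := pos s rs; rewrite EP// EPhi// !(mulrCA _ (gauss t s)).
  by rewrite ler_wpM2l ?(ltW (gauss_gt0 _ _))// lePhi.
have [intu leu] := excess_integral_le r0 t0 (cP t t0) dB B0M leBP (intf t t0).
have intqf : mu.-integrable `]r, +oo[ (EFin \o (fun s => q * f t s)).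
  apply: integrable_scale; exact: intf.
have int1 : mu.-integrable `]r, +oo[ (EFin \o
    (fun s => (4 * t ^+ 2)^-1 * ((s ^+ 2 - r ^+ 2) * f t s))).
  apply: integrable_scale; exact: intu.
have int2 : mu.-integrable `]r, +oo[ (EFin \o (fun s => N%:R / t * f t s)).
  apply: integrable_scale; exact: intf.
have intd : mu.-integrable `]r, +oo[ (EFin \o (fun s => f1 t s - q * f t s)).
  exact: integrable_sub intf1 intqf.
have intr : mu.-integrable `]r, +oo[ (EFin \o (fun s =>
    (4 * t ^+ 2)^-1 * ((s ^+ 2 - r ^+ 2) * f t s) + N%:R / t * f t s)).
  exact: integrable_add int1 int2.
rewrite -RintegralZl//; last exact: intf.
rewrite -RintegralB//.
apply: (le_trans (le_normr_Rintegral _ intd)) => //.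
apply: (@le_trans _ _ (\int[mu]_(s in `]r, +oo[)
   ((4 * t ^+ 2)^-1 * ((s ^+ 2 - r ^+ 2) * f t s) + N%:R / t * f t s))).
  apply: le_Rintegral => //; first exact: integrable_norm.
  move=> s /Drs rs; have s0 := pos s rs; have [_ leN] := dtP t s t0 s0.
  have k0 := abel_kernel_ge0 r0 rs.
  have -> : f1 t s - q * f t s = (4 * t ^+ 2)^-1 * ((s ^+ 2 - r ^+ 2) * f t s)
      - abel_kernel r s * (gauss t s * b' t s).
    by rewrite /f1 /q /f; ring.
  apply: le_trans (ler_normB _ _) _.
  have u0 : 0 <= s ^+ 2 - r ^+ 2.
    by rewrite subr_ge0 lerXn2r ?nnegrE ?(ltW r0) ?(ltW s0) ?(ltW rs).
  have gb0 : 0 <= gauss t s * b' t s.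
    by rewrite mulr_ge0 ?(ltW (gauss_gt0 _ _)) ?(amplitude_ge0 ab').
  have i0 : 0 <= (4 * t ^+ 2)^-1 by rewrite invr_ge0 mulr_ge0 ?sqr_ge0.
  rewrite ger0_norm; last by apply: mulr_ge0 => //; apply: mulr_ge0 => //;
    exact: f0.
  rewrite ger0_norm; last by rewrite mulr_ge0.
  have -> : N%:R / t * f t s = abel_kernel r s * (N%:R / t * Dsinh (Phi t) s).
    by rewrite /f mulrCA.
  by rewrite lerD2l ler_wpM2l.
rewrite RintegralD// RintegralZl// RintegralZl//; last exact: intf.
have -> : N.+1%:R / t * F t = t^-1 * F t + N%:R / t * F t.
  by rewrite -natr1; move: (F t) => y; ring.
apply: lerD; last exact: lexx.
have -> : t^-1 * F t = (4 * t ^+ 2)^-1 * (4 * t * F t) by field.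
by apply: ler_wpM2l; [rewrite invr_ge0 mulr_ge0 ?sqr_ge0 | exact: leu].
Qed.

End AbelTransformOfAmplitude.

Unset Implicit Arguments.

Theorem proposition6p2 (R : realType) (S : damek_ricci R) :
  exists C : R, 0 < C /\
    forall r t : R, 0 < r -> 0 < t ->
      derivable (fun u : R => heat_kernel S u r) t 1 /\
      `| (fun u : R => heat_kernel S u r)^`()%classic t | <=
        C * (`| r ^+ 2 / (4 * t ^+ 2) - dr_Q S ^+ 2 / 4 | + 1 / t)
          * heat_kernel S t r.
Proof.
have c0 : 0 <= heat_c0 S by apply: mulr_ge0; exact: powR_ge0.
rewrite /heat_kernel; case nu_parity: (odd (dr_nu S)).
- have [b Hb] := @gauss_amplitude_iter R (dr_mu S)./2 (dr_nu S)./2.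
  have [N HN] := abel_transform_time_derivative Hb.
  exists (N%:R + 1); split; first by rewrite ltr_pwDr.
  move=> r t r0 t0; case: (HN r t r0 t0) => F0 [dF dFt leF].
  have -> : ((dr_nu S).+1)./2 = ((dr_nu S)./2).+1.
    by rewrite -uphalfE uphalf_half nu_parity.
  have A0 : 0 <= heat_c0 S * pi `^ (- (1 / 2)) by apply: mulr_ge0 => //;
    exact: powR_ge0.
  exact: (time_prefactor_bound (dr_Q S) A0 (ler0n R N) t0 F0 dFt leF).
- have [b Hb] := @gauss_amplitude_iter R (dr_mu S)./2 (dr_nu S)./2.
  have [N [b' ab' HN]] := gauss_amplitude_time_derivative Hb.
  exists (N%:R + 1); split; first by rewrite ltr_pwDr.
  move=> r t r0 t0; have [dX leX] := HN t r t0 r0.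
  apply: (time_prefactor_bound (dr_Q S) c0 (ler0n R N) t0 _ dX).
  + have [ab E] := Hb; rewrite E// mulr_ge0 ?(amplitude_ge0 ab)//.
    exact/ltW/gauss_gt0.
  + rewrite addrAC subrr add0r normrN ger0_norm//.
    rewrite mulr_ge0 ?(amplitude_ge0 ab')//.
    exact/ltW/gauss_gt0.
Qed.
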